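(* Let $G_p$ and $G_c$ be IF-OFP systems with passivity indices $(\nu_p,\rho_p)$ and $(\nu_c,\rho_c)$ respectively, $\nu_p,\rho_p,\nu_c,\rho_c\in\mathbb{R}$, interconnected in the two-sided event-triggered feedback loop described in the context, where the event instants $t_{p_k}$ and $t_{c_k}$ are determined by the conditions $\|e_p(t)\|_2^2>\delta_p\|y_p(t)\|_2^2$ with $\delta_p\in(0,1]$ and $\|e_c(t)\|_2^2>\delta_c\|y_c(t)\|_2^2$ with $\delta_c\in(0,1]$, respectively. Put $w(t)=\begin{bmatrix} w_1(t)\\ w_2(t)\end{bmatrix}$, $y(t)=\begin{bmatrix} y_p(t)\\ y_c(t)\end{bmatrix}$. Then the event-triggered networked control system is QSR-dissipative with respect to the inputs $w$ and outputs $y$, and satisfies $$\dot V(t)\le w^T(t)Rw(t)+2w^T(t)Sy(t)+y^T(t)Qy(t)$$ for a storage function $V$ of the interconnection, where $$S=\begin{bmatrix}\tfrac12 I&\nu_p I\\-\nu_c I&\tfrac12 I\end{bmatrix},\quad R=\begin{bmatrix}-(\nu_p-|\nu_p|) I&0\\0&-(\nu_c-|\nu_c|)I\end{bmatrix},\quad Q=\begin{bmatrix}-(\beta(\nu_c)-\tfrac14)I&0\\0&-(\beta(\nu_p)-\tfrac14)I\end{bmatrix}$$ and $$\beta(\nu_p)=\begin{cases}\rho_c-\nu_p-\delta_c(1+\nu_p)&\text{if }\nu_p>0,\\ \rho_c-\delta_c&\text{if }\nu_p=0,\\ \rho_c+2\nu_p-\delta_c(1-3\nu_p)&\text{if }\nu_p<0,\end{cases}\qquad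 \beta(\nu_c)=\begin{cases}\rho_p-\nu_c-\delta_p(1+\nu_c)&\text{if }\nu_c>0,\\ \rho_p-\delta_p&\text{if }\nu_c=0,\\ \rho_p+2\nu_c-\delta_p(1-3\nu_c)&\text{if }\nu_c<0.\end{cases}$$ Additionally, if $Q<0$, that is, $\beta(\nu_c)>\tfrac14$ and $\beta(\nu_p)>\tfrac14$, then the interconnection is (finite gain) $L_2$-stable from $w$ to $y$.
   Context: Systems: a system $G$ has the form $\dot x=f(x,u)$, $y=h(x,u)$ with state $x\in X\subset\mathbb{R}^n$ and $u(t),y(t)\in\mathbb{R}^m$. A storage function is a nonnegative function $V$ of the state; it is taken differentiable, and $\dot V(t)$ is the time derivative along solutions. $G$ is IF-OFP (input feed-forward output feedback passive) with input passivity index $\nu\in\mathbb{R}$ and output passivity index $\rho\in\mathbb{R}$ (of either sign) if there is a storage function $V$ with $\dot V\le u^Ty-\rho y^Ty-\nu u^Tu$ for all $t$ along all solutions. Two-sided event-triggered loop: $G_p$ (plant, state $x_p$, input $u_p$, output $y_p$) has indices $(\nu_p,\rho_p)$, and $G_c$ (controller, state $x_c$, input $u_c$, output $y_c$) has indices $(\nu_c,\rho_c)$; all inputs and outputs are $\mathbb{R}^m$-valued. External signals $w_1,w_2$ are $\mathbb{R}^m$-valued. At event instants $t_{p_k}$ the plant output is sampled, sent to the controller and held until the next plant event; at event instants $t_{c_k}$ the controller output is sampled, sent to the plant and held until the next controller event. With $e_p(t)=y_p(t)-y_p(t_{p_k})$ for $t\in[t_{p_k},t_{p_{k+1}})$ and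 $e_c(t)=y_c(t)-y_c(t_{c_k})$ for $t\in[t_{c_k},t_{c_{k+1}})$, the inputs are $u_c(t)=w_2(t)+y_p(t_{p_k})=w_2(t)+y_p(t)-e_p(t)$ and $u_p(t)=w_1(t)-y_c(t_{c_k})=w_1(t)+e_c(t)-y_c(t)$. A new plant (resp. controller) event is triggered as soon as $\|e_p(t)\|_2^2>\delta_p\|y_p(t)\|_2^2$ (resp. $\|e_c(t)\|_2^2>\delta_c\|y_c(t)\|_2^2$), Euclidean norms at time $t$, so that $e_p^Te_p\le\delta_p y_p^Ty_p$ and $e_c^Te_c\le\delta_c y_c^Ty_c$ hold at all times. A storage function of the interconnection is a nonnegative function $V$ of $(x_p,x_c)$; inequalities on $\dot V$ are required along all solutions for all $t$ in the inter-event intervals. A system with input $w$ and output $y$ is QSR-dissipative if there is a storage function $V$ with $\dot V\le y^TQy+2y^TSw+w^TRw$ (dissipative with a quadratic supply rate, up to transposing $S$), with $Q,S,R$ constant matrices and $Q,R$ symmetric. It is finite gain $L_2$-stable if there are a positive semidefinite function $V$ of the state and a constant $\gamma>0$ such that $V(t_1)-V(0)\le\int_0^{t_1}(\gamma^2w^Tw-y^Ty)\,dt$ for all inputs and all $t_1>0$. $I$ is the $m\times m$ identity. *)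

(* Defs.v *)
From HB Require Import structures.
From mathcomp Require Import all_boot all_order all_algebra.
From mathcomp Require Import all_classical all_reals all_analysis.

Set Implicit Arguments.
Unset Strict Implicit.
Unset Printing Implicit Defensive.

Import Order.TTheory GRing.Theory Num.Theory.
Import numFieldNormedType.Exports.

Local Open Scope classical_set_scope.
Local Open Scope ring_scope.

Section Vectors.
Variable R : realType.

(* x^T A y; the norm `|_| of a matrix in the library is the max norm, so the
   Euclidean norm is written through [dot]. *)
Definition bform p q (x : 'cV[R]_p) (A : 'M[R]_(p, q)) (y : 'cV[R]_q) : R :=
  (x^T *m A *m y) ord0 ord0.

Definition dot p (x y : 'cV[R]_p) : R := (x^T *m y) ord0 ord0.

Definition negative_definite p (A : 'M[R]_p) : Prop :=
  forall x : 'cV[R]_p, x != 0 -> bform x A x < 0.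

End Vectors.

Section Behaviours.
Variable R : realType.

(* The interval [0, T[, with T possibly infinite. *)
Definition horizon (T : \bar R) : set R := [set t | 0 <= t /\ (t%:E < T)%E].

(* Finitely many discontinuities on bounded intervals, with one-sided limits. *)
Definition piecewise_continuous p (T : \bar R) (u : R -> 'cV[R]_p) : Prop :=
  [/\ forall t, horizon T t -> cvg (u @ t^'+),
      forall t, horizon T t -> 0 < t -> cvg (u @ t^'-) &
      forall t1, horizon T t1 ->
        finite_set [set t | 0 < t <= t1 /\ ~ {for t, continuous u}]].

(* A system with memory seen from outside: [B T w x y J] means that w, x, y are
   the input, state and output along a solution on [0, T[, and that J is the set
   of times at which V(x(t)) has to satisfy a dissipation inequality (the times
   at which the solution satisfies its differential equation). Values of the
   signals outside [0, T[ are irrelevant. *)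
Definition behaviour (Z : Type) (p q : nat) : Type :=
  \bar R -> (R -> 'cV[R]_p) -> (R -> Z) -> (R -> 'cV[R]_q) -> set R -> Prop.

Section Dissipativity.
Variables (Z : normedModType R) (p q : nat).
Implicit Types (X : set Z) (B : behaviour Z p q) (V : Z -> R).

(* X is not assumed open: V is differentiable in the ambient space at every
   point of X. *)
Definition storage_function X V : Prop :=
  (forall x, X x -> 0 <= V x) /\ (forall x, X x -> differentiable V x).

Definition dissipation_inequality B V (s : 'cV[R]_p -> 'cV[R]_q -> R) : Prop :=
  forall T w x y J, B T w x y J ->
    forall t, J t -> derive1 (V \o x) t <= s (w t) (y t).

Definition QSR_dissipative X B
    (Qm : 'M[R]_q) (Sm : 'M[R]_(q, p)) (Rm : 'M[R]_p) : Prop :=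
  [/\ Qm^T = Qm, Rm^T = Rm &
    exists V, storage_function X V /\
      dissipation_inequality B V
        (fun w y => bform y Qm y + 2 * bform y Sm w + bform w Rm w)].

(* Positive semidefiniteness of V means 0 <= V on X, without V(0) = 0. *)
Definition finite_gain_L2_stable X B : Prop :=
  exists V (gamma : R),
    [/\ forall x, X x -> 0 <= V x,
        0 < gamma &
        forall T w x y J, B T w x y J ->
          forall t1 : R, 0 < t1 -> (t1%:E < T)%E ->
            V (x t1) - V (x 0) <=
            \int[lebesgue_measure]_(t in `[0, t1])
              (gamma ^+ 2 * dot (w t) (w t) - dot (y t) (y t))].

End Dissipativity.

(* x' = dynamics x u, y = output x u, on states; only the values of the two
   maps on states are relevant. *)
Record system (n m : nat) := System {
  states : set 'cV[R]_n ;
  dynamics : 'cV[R]_n -> 'cV[R]_m -> 'cV[R]_n ;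
  output : 'cV[R]_n -> 'cV[R]_m -> 'cV[R]_m }.

(* Solutions with piecewise continuous inputs and outputs: x is continuous and satisfies the
   differential equation at every interior time at which u is continuous. *)
Definition solution n m (G : system n m) : behaviour 'cV[R]_n m m :=
  fun T u x y J =>
  [/\ piecewise_continuous T u /\ piecewise_continuous T y,
      {within horizon T, continuous x} /\
        (forall t, horizon T t -> states G (x t)),
      forall t, horizon T t -> y t = output G (x t) (u t),
      J = [set t | [/\ horizon T t, 0 < t & {for t, continuous u}]] &
      forall t, J t -> is_derive t 1 x (dynamics G (x t) (u t))].

Definition IF_OFP n m (G : system n m) (nu rho : R) : Prop :=
  exists V : 'cV[R]_n -> R, storage_function (states G) V /\
    dissipation_inequality (solution G) V
      (fun u y => dot u y - rho * dot y y - nu * dot u u).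

(* Event instants tau 0 = 0 < tau 1 < ... of a signal y on [0, T[: the next
   event is the infimum of the later times at which
   ||y(t) - y(tau k)||^2 > delta ||y(t)||^2, and is +oo, the infimum of the
   empty set, if there is no such time. The last clause says that the event
   instants do not accumulate in [0, T[ and that each of them is strictly later
   than the previous one, as the intervals [tau k, tau k.+1[ cover [0, T[. *)
Definition event_instants m (T : \bar R) (delta : R) (y : R -> 'cV[R]_m)
    (tau : nat -> \bar R) : Prop :=
  [/\ tau 0%N = 0%E,
      forall k, tau k.+1 = ereal_inf (EFin @` [set t | [/\ (tau k < t%:E)%E,
        (t%:E < T)%E &
        let e := y t - y (fine (tau k)) in
        delta * dot (y t) (y t) < dot e e]]) &
      forall t, horizon T t -> exists k, (tau k <= t%:E < tau k.+1)%E].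

Definition sample_and_hold m (T : \bar R) (tau : nat -> \bar R)
    (y yh : R -> 'cV[R]_m) : Prop :=
  forall k t, horizon T t -> (tau k <= t%:E < tau k.+1)%E ->
    yh t = y (fine (tau k)).

Definition inter_event (tau : nat -> \bar R) : set R :=
  [set t | exists k, (tau k < t%:E < tau k.+1)%E].

(* The two-sided event-triggered loop, with input (w1, w2), state (xp, xc) and
   output (yp, yc). *)
Definition event_triggered_loop np nc m
    (Gp : system np m) (Gc : system nc m) (delta_p delta_c : R) :
    behaviour ('cV[R]_np * 'cV[R]_nc)%type (m + m) (m + m) :=
  fun T w x y J =>
  let w1 t := usubmx (w t) in let w2 t := dsubmx (w t) in
  let yp t := usubmx (y t) in let yc t := dsubmx (y t) in
  piecewise_continuous T w /\
  exists (up uc yph ych : R -> 'cV[R]_m) (tp tc : nat -> \bar R) (Jp Jc : set R),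
  [/\ solution Gp T up (fun t => (x t).1) yp Jp /\
        solution Gc T uc (fun t => (x t).2) yc Jc,
      event_instants T delta_p yp tp /\ event_instants T delta_c yc tc,
      sample_and_hold T tp yp yph /\ sample_and_hold T tc yc ych,
      forall t, horizon T t -> uc t = w2 t + yph t /\ up t = w1 t - ych t &
      J = [set t | [/\ horizon T t, inter_event tp t, inter_event tc t &
                       {for t, continuous w}]]].

End Behaviours.

(* beta(nu) of one subsystem, with rho and delta those of the other one. *)
Definition beta (R : realType) (rho delta nu : R) : R :=
  if 0 < nu then rho - nu - delta * (1 + nu)
  else if nu == 0 then rho - delta
  else rho + 2 * nu - delta * (1 - 3 * nu).

(* Main.v *)
Require Import Defs.
From HB Require Import structures.
From mathcomp Require Import all_boot all_order all_algebra.
From mathcomp Require Import all_classical all_reals all_analysis.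
From mathcomp Require Import ring lra.
Import Order.TTheory GRing.Theory Num.Theory.
Import numFieldNormedType.Exports.
Local Open Scope classical_set_scope.
Local Open Scope ring_scope.

(** The storage function of the loop is the sum [Vp + Vc] of the storage
    functions of the two subsystems. Adding their dissipation inequalities, the
    feedback interconnection cancels the products of the true outputs, so that
    the sampling errors [ep] and [ec] enter only through [ec . yp - ep . yc] and
    through the terms [- nu_p |up|^2] and [- nu_c |uc|^2]. Between events the
    triggering rule gives [|ep|^2 <= delta_p |yp|^2] and
    [|ec|^2 <= delta_c |yc|^2], so elementary estimates of the form
    [2 a . b <= |a|^2 + |b|^2] absorb the errors into the coefficients of
    [|yp|^2] and [|yc|^2]; the three cases of [beta] are the signs of [nu]
    ([held_input_bound], [loop_supply_le]). The inequality holds at the right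
    times because the held signals are locally constant between events, so that
    both subsystems have continuous inputs there ([loop_subsystems]).

    If [Q] is negative definite, then [y^T Q y <= - eps |y|^2] for some
    [eps > 0], and Young's inequality applied to [2 w^T S y] shows that a
    multiple of [Vp + Vc] satisfies [V' <= gamma^2 |w|^2 - |y|^2]
    ([quadratic_supply_gain]). It remains to integrate along a solution. The
    inequality holds off a finite set of times, since the events do not
    accumulate and the signals are piecewise continuous; [V] is continuous
    along the solution, and the right-hand side is bounded and continuous off a
    finite set, so the comparison with its integral is the fundamental theorem
    of calculus followed by the mean value theorem
    ([le_Rintegral_off_finite], [loop_finite_gain]). *)

(** * Euclidean products and quadratic supply rates *)

Section EuclideanAlgebra.
Context {R : realType}.

Lemma dotE {p} (x y : 'cV[R]_p) : dot x y = \sum_i x i ord0 * y i ord0.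
Proof. by rewrite /dot mxE; apply: eq_bigr => i _; rewrite mxE. Qed.

Lemma dotC {p} (x y : 'cV[R]_p) : dot x y = dot y x.
Proof. by rewrite !dotE; apply: eq_bigr => i _; rewrite mulrC. Qed.

Lemma dotDl {p} (x y z : 'cV[R]_p) : dot (x + y) z = dot x z + dot y z.
Proof. by rewrite /dot linearD mulmxDl mxE. Qed.

Lemma dotDr {p} (x y z : 'cV[R]_p) : dot x (y + z) = dot x y + dot x z.
Proof. by rewrite dotC dotDl !(dotC x). Qed.

Lemma dotNl {p} (x y : 'cV[R]_p) : dot (- x) y = - dot x y.
Proof. by rewrite /dot linearN mulNmx mxE. Qed.

Lemma dotNr {p} (x y : 'cV[R]_p) : dot x (- y) = - dot x y.
Proof. by rewrite dotC dotNl dotC. Qed.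

Lemma dotZl {p} a (x y : 'cV[R]_p) : dot (a *: x) y = a * dot x y.
Proof. by rewrite /dot linearZ -scalemxAl mxE. Qed.

Lemma dotZr {p} a (x y : 'cV[R]_p) : dot x (a *: y) = a * dot x y.
Proof. by rewrite dotC dotZl dotC. Qed.

Definition dot_bilinear := (@dotDl, @dotDr, @dotNl, @dotNr, @dotZl, @dotZr).

Lemma dot_ge0 {p} (x : 'cV[R]_p) : 0 <= dot x x.
Proof. by rewrite dotE sumr_ge0 // => i _; rewrite -expr2 sqr_ge0. Qed.

Lemma dot_gt0 {p} (x : 'cV[R]_p) : x != 0 -> 0 < dot x x.
Proof.
move=> x0; rewrite lt0r dot_ge0 andbT dotE; apply: contra x0.
rewrite psumr_eq0 => [/allP x0|i _]; last by rewrite -expr2 sqr_ge0.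
apply/eqP/matrixP => i j; rewrite ord1 mxE.
by have := x0 i; rewrite mem_index_enum mulf_eq0 orbb => /(_ isT) /eqP.
Qed.

Lemma dot_col_mx {p q} (x x' : 'cV[R]_p) (y y' : 'cV[R]_q) :
  dot (col_mx x y) (col_mx x' y') = dot x x' + dot y y'.
Proof. by rewrite /dot tr_col_mx mul_row_col mxE. Qed.

Lemma dot_vsub {p q} (x y : 'cV[R]_(p + q)) :
  dot x y = dot (usubmx x) (usubmx y) + dot (dsubmx x) (dsubmx y).
Proof. by rewrite -dot_col_mx !vsubmxK. Qed.

Lemma bform_dot {p q} (x : 'cV[R]_p) (A : 'M[R]_(p, q)) (y : 'cV[R]_q) :
  bform x A y = dot x (A *m y).
Proof. by rewrite /bform /dot mulmxA. Qed.

Lemma bform_tr {p q} (x : 'cV[R]_p) (A : 'M[R]_(p, q)) (y : 'cV[R]_q) :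
  bform y A^T x = bform x A y.
Proof. by rewrite !bform_dot dotC /dot trmx_mul trmxK -mulmxA. Qed.

Lemma bform_scalar_block {m} (x y : 'cV[R]_(m + m)) (a b c d : R) :
  bform x (block_mx a%:M b%:M c%:M d%:M) y =
    a * dot (usubmx x) (usubmx y) + b * dot (usubmx x) (dsubmx y) +
    (c * dot (dsubmx x) (usubmx y) + d * dot (dsubmx x) (dsubmx y)).
Proof.
rewrite bform_dot -{1}(vsubmxK y) mul_block_col dot_vsub.
by rewrite col_mxKu col_mxKd !mul_scalar_mx !dotDr !dotZr.
Qed.

(** The difference of the two sides is [k^-1 |x - k y|^2]. *)
Lemma young {p} (k : R) (x y : 'cV[R]_p) : 0 < k ->
  2 * dot x y <= k^-1 * dot x x + k * dot y y.
Proof.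
move=> k0; have k0' : 0 <= k^-1 by rewrite invr_ge0 ltW.
have := mulr_ge0 k0' (dot_ge0 (x - k *: y)).
rewrite !dot_bilinear (dotC y x).
have -> :
  k^-1 * (dot x x - k * dot x y + (- (k * dot x y) - k * - (k * dot y y)))
  = k^-1 * dot x x - 2 * dot x y + k * dot y y by field; rewrite gt_eqF.
lra.
Qed.

(** Every entry contributes at most [|A i j| |x i| |x j|], and
    [|x i| |x j| <= |x|^2]. *)
Lemma bform_bounded {p} (A : 'M[R]_p) :
  exists2 C : R, 0 <= C & forall x : 'cV[R]_p, bform x A x <= C * dot x x.
Proof.
exists (\sum_i \sum_j `|A i j|) => [|x].
  by apply: sumr_ge0 => i _; apply: sumr_ge0.
have coord i : `|x i ord0| ^+ 2 <= dot x x.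
  rewrite real_normK ?num_real // dotE (bigD1 i) //= -expr2 lerDl.
  by rewrite sumr_ge0 // => j _; rewrite -expr2 sqr_ge0.
rewrite bform_dot dotE mulr_suml ler_sum // => i _.
rewrite mxE mulr_sumr mulr_suml ler_sum // => j _.
rewrite (le_trans (ler_norm _)) // !normrM mulrCA ler_wpM2l //.
have := coord i; have := coord j.
by have := sqr_ge0 (`|x i ord0| - `|x j ord0|); nra.
Qed.

Lemma bform_diag_block {m} (x y : 'cV[R]_(m + m)) (a d : R) :
  bform x (block_mx a%:M 0 0 d%:M) y =
    a * dot (usubmx x) (usubmx y) + d * dot (dsubmx x) (dsubmx y).
Proof.
have := bform_scalar_block x y a 0 0 d.
by rewrite raddf0 !mul0r addr0 add0r.
Qed.

(** A vector supported on one block detects the sign of that block. *)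
Lemma negative_definite_diag_block {m} (a d : R) : (0 < m)%N ->
  negative_definite (block_mx (- a)%:M 0 0 (- d)%:M : 'M[R]_(m + m)) <->
  0 < a /\ 0 < d.
Proof.
move=> m0; pose v : 'cV[R]_m := const_mx 1.
have v0 : v != 0.
  apply/eqP => /matrixP/(_ (Ordinal m0) ord0); rewrite !mxE => /eqP.
  by rewrite oner_eq0.
have vv := dot_gt0 v v0.
have zz : dot (0 : 'cV[R]_m) 0 = 0 by rewrite /dot mulmx0 mxE.
split=> [nd|[a0 d0] x x0].
- have ndv := nd (col_mx v 0); have nd0v := nd (col_mx 0 v).
  move: ndv nd0v.
  rewrite !bform_diag_block !col_mxKu !col_mxKd !col_mx_eq0 !zz (negbTE v0).
  by rewrite andbF /= !mulr0 addr0 add0r !mulNr !oppr_lt0 !(pmulr_lgt0 _ vv);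
    split; auto.
- rewrite bform_diag_block !mulNr -opprD oppr_lt0.
  have := x0; rewrite -(vsubmxK x) col_mx_eq0 negb_and col_mxKu col_mxKd.
  have u_ge0 := dot_ge0 (usubmx x); have d_ge0 := dot_ge0 (dsubmx x).
  by case/orP => /dot_gt0 gt0; [apply: ltr_wpDr|apply: ltr_wpDl];
    rewrite ?mulr_gt0 ?mulr_ge0 // ltW.
Qed.

(** The cross term [2 w^T S y] costs at most half of the output decay [eps]
    (Young's inequality with weight [eps / 2]); the other half survives, and
    rescaling by [k = 2 / eps] turns it into the [- |y|^2] of the definition of
    the gain. What remains is a quadratic form in [w], hence a multiple of
    [|w|^2]. *)
Lemma quadratic_supply_gain {p q} (Q : 'M[R]_q) (S : 'M[R]_(p, q))
    (P : 'M[R]_p) (eps : R) :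
  0 < eps -> (forall y, bform y Q y <= - eps * dot y y) ->
  exists k gamma : R, [/\ 0 < k, 0 < gamma & forall w y,
    k * (bform w P w + 2 * bform w S y + bform y Q y) <=
    gamma ^+ 2 * dot w w - dot y y].
Proof.
move=> e0 Qe; have e20 : 0 < eps / 2 by rewrite divr_gt0.
have [C1 C10 S_C1] := bform_bounded (S *m S^T).
have [C2 C20 P_C2] := bform_bounded P.
pose k := (eps / 2)^-1.
have k0 : 0 < k by rewrite invr_gt0.
(* The summand 1 makes the gain positive even if [C1 = C2 = 0]. *)
pose K := k * (k * C1 + C2) + 1.
have K0 : 0 < K.
  by rewrite ltr_wpDl // mulr_ge0 ?addr_ge0 ?mulr_ge0 // ltW.
exists k, (Num.sqrt K); split; rewrite ?sqrtr_gt0 // => w y.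
rewrite sqr_sqrtr ?(ltW K0) //.
have adj z : bform w S z = dot (S^T *m w) z.
  by rewrite -bform_tr bform_dot dotC.
have cross : 2 * bform w S y <= k * bform w (S *m S^T) w + eps / 2 * dot y y.
  rewrite (bform_dot w (S *m S^T)) -mulmxA -(bform_dot w S) !adj.
  exact: young.
have kk : k * (eps / 2) = 1 by rewrite mulVf ?gt_eqF.
have ww := dot_ge0 w.
apply: (@le_trans _ _ (k * ((k * C1 + C2) * dot w w - eps / 2 * dot y y))).
  rewrite ler_wpM2l ?(ltW k0) //.
  have := ler_wpM2l (ltW k0) (S_C1 w); have := P_C2 w; have := Qe y.
  by lra.
by rewrite mulrBr (mulrA k (eps / 2)) kk mul1r lerD2r mulrA mulrDl mul1r lerDl.
Qed.

End EuclideanAlgebra.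

(** * The supply rate of the interconnection *)

Section LoopAlgebra.
Context {R : realType} {m : nat}.

(** The share of one subsystem in the supply rate. [w] is an external input,
    [y] an output fed back with sampling error [e], so that [w - (y - e)] is the
    input of the other subsystem, whose output is [z]. Three estimates are
    combined with [|e|^2 <= delta |y|^2]:
    - [e . z <= |z|^2 / 4 + |e|^2], where the constant 1/4 in [Q] comes from;
    - if [0 < nu], completing the square in [w] gives
      [- nu |w - (y - e)|^2 =
       2 nu w . y - nu |w + e|^2 - nu |y|^2 + 2 nu y . e],
      and [2 y . e <= |y|^2 + |e|^2];
    - if [nu < 0], [2 w . e <= |w|^2 + |e|^2] and
      [|y - e|^2 <= 2 |y|^2 + 2 |e|^2], which produces the factor 3 in [beta].
    Adding [- rho |y|^2], the output term of the same channel, assembles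
    [beta]. *)
Lemma held_input_bound (nu rho delta : R) (w e y z : 'cV[R]_m) :
  0 < delta -> dot e e <= delta * dot y y ->
  - nu * dot (w - (y - e)) (w - (y - e)) + dot e z - rho * dot y y <=
  - (nu - `|nu|) * dot w w + 2 * nu * dot w y + 4^-1 * dot z z
  - beta rho delta nu * dot y y.
Proof.
move=> d0 he.
have ez := dot_ge0 (e - 2^-1 *: z).
have ye := dot_ge0 (y - e); have y_e := dot_ge0 (y + e).
have we := dot_ge0 (w + e); have w_e := dot_ge0 (w - e).
have y0 := dot_ge0 y.
move: ez ye y_e we w_e; rewrite !dot_bilinear.
rewrite (dotC e w) (dotC y w) (dotC z e) (dotC e y).
move: (dot w w) (dot w e) (dot w y) (dot e e) (dot y e) (dot y y)
  (dot e z) (dot z z) he y0 => ww we wy ee ye yy ez zz he y0 h1 h2 h3 h4 h5.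
rewrite /beta; have [n0|n0|->] := ltgtP nu 0.
- rewrite ltr0_norm //=. nra.
- rewrite gtr0_norm //. nra.
- rewrite normr0. lra.
Qed.

(** Negative feedback cancels the power exchanged by the true outputs, namely
    [- yc . yp + yp . yc = 0]; only [ec . yp - ep . yc] is left of it. Each
    error term goes with the input feedforward term containing the same error.
    The controller side is the plant side with [w] and [z] negated, because
    [uc = - (- w2 - (yp - ep))]. *)
Lemma loop_supply_le (delta_p delta_c nu_p rho_p nu_c rho_c : R)
    (w1 w2 yp yc ep ec up uc : 'cV[R]_m) :
  0 < delta_p -> 0 < delta_c ->
  dot ep ep <= delta_p * dot yp yp -> dot ec ec <= delta_c * dot yc yc ->
  up = w1 - (yc - ec) -> uc = w2 + (yp - ep) ->
  (dot up yp - rho_p * dot yp yp - nu_p * dot up up) +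
  (dot uc yc - rho_c * dot yc yc - nu_c * dot uc uc) <=
  - (nu_p - `|nu_p|) * dot w1 w1 - (nu_c - `|nu_c|) * dot w2 w2
  + 2 * (2^-1 * dot w1 yp + nu_p * dot w1 yc
         - nu_c * dot w2 yp + 2^-1 * dot w2 yc)
  - (beta rho_p delta_p nu_c - 4^-1) * dot yp yp
  - (beta rho_c delta_c nu_p - 4^-1) * dot yc yc.
Proof.
move=> dp0 dc0 hep hec upE ucE.
have := held_input_bound nu_p rho_c delta_c w1 ec yc yp dc0 hec.
have := held_input_bound nu_c rho_p delta_p (- w2) ep yp (- yc) dp0 hep.
rewrite -upE -opprD -ucE !(dotNl, dotNr) !opprK.
have -> : dot up yp = dot w1 yp - dot yc yp + dot ec yp.
  by rewrite upE !dot_bilinear; lra.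
have -> : dot uc yc = dot w2 yc + dot yc yp - dot ep yc.
  by rewrite ucE !dot_bilinear (dotC yp yc); lra.
by lra.
Qed.

End LoopAlgebra.

(** * Signals and integration off finite sets *)

Section Regularity.
Context {R : realType}.
Notation mu := (@lebesgue_measure R).

(** Neighbourhoods of a matrix are generated by boxes. *)
Lemma mx_continuous {T : topologicalType} {p q} (f : T -> 'M[R]_(p, q)) x :
  (forall i j, {for x, continuous (fun t => f t i j)}) ->
  {for x, continuous f}.
Proof.
move=> cf A [P nP PA]; rewrite nbhs_filterE.
apply: (filterS (fun t => @PA (f t))).
by apply: filter_forall => i; apply: filter_forall => j; exact: cf (nP i j).
Qed.

Lemma usubmx_continuous {p q} : continuous (@usubmx R p q 1).
Proof.
move=> x; apply: mx_continuous => i j.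
rewrite (_ : (fun t => _) = fun t : 'M[R]_(p + q, 1) => t (lshift q i) j).
  exact: coord_continuous.
by apply/funext => t; rewrite mxE.
Qed.

Lemma dsubmx_continuous {p q} : continuous (@dsubmx R p q 1).
Proof.
move=> x; apply: mx_continuous => i j.
rewrite (_ : (fun t => _) = fun t : 'M[R]_(p + q, 1) => t (rshift p i) j).
  exact: coord_continuous.
by apply/funext => t; rewrite mxE.
Qed.

Lemma dot_sqr_continuous {p} : continuous (fun x : 'cV[R]_p => dot x x).
Proof.
under eq_fun do rewrite dotE.
apply: continuous_big => [|i _]; first exact: add_continuous.
by move=> x; apply: continuousM; exact: coord_continuous.
Qed.

Lemma cvg_locally_bounded {F : set_system R} (f : R -> R) :
  Filter F -> cvg (f @ F) -> exists M : R, \forall s \near F, `|f s| <= M.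
Proof.
move=> FF /cvg_ex[l fl]; exists (`|l| + 1).
have /cvgrPdist_le/(_ 1 ltr01) := fl; apply: filterS => s ls.
by rewrite -(subrK l (f s)) addrC (le_trans (ler_normD _ _)) // lerD2l distrC.
Qed.

(** One-sided limits bound [u] on each side of [t]; the value at [t] itself may
    differ from both. The guard [0 <= s] is there because nothing is known to
    the left of time 0. *)
Lemma sqr_locally_bounded {p} {T : \bar R} {u : R -> 'cV[R]_p} {t} :
  piecewise_continuous T u -> horizon T t ->
  exists M : R, \forall s \near t, 0 <= s -> `|dot (u s) (u s)| <= M.
Proof.
move=> [rlim llim _] ht.
have bounded (F : set_system R) : Filter F -> cvg (u @ F) ->
    exists M : R, \forall s \near F, `|dot (u s) (u s)| <= M.
  move=> FF /cvg_ex[l ul].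
  apply: (cvg_locally_bounded (fun s => dot (u s) (u s))); apply/cvg_ex.
  exists (dot l l).
  exact: (cvg_comp u (fun x => dot x x) ul (dot_sqr_continuous l)).
have [Mr hr] := bounded _ _ (rlim t ht).
have [Ml hl] : exists M : R,
    \forall s \near t, s < t -> 0 <= s -> `|dot (u s) (u s)| <= M.
  have [t0|t0] := ltP 0 t.
    have [M hM] := bounded _ _ (llim t ht t0); exists M.
    have {}hM : \forall s \near t, s < t -> `|dot (u s) (u s)| <= M by [].
    by apply: filterS hM => s hs st _; exact: hs.
  exists 0; near=> s => st s0; exfalso.
  by move: (le_lt_trans s0 (lt_le_trans st t0)); rewrite ltxx.
exists (`|dot (u t) (u t)| + (`|Mr| + `|Ml|)).
have {}hr : \forall s \near t, t < s -> `|dot (u s) (u s)| <= Mr by [].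
near=> s => s0; have [st|st|->] := ltgtP s t.
- apply: (@le_trans _ _ Ml); first by move: s0; apply: (near hl s).
  have := ler_norm Ml; have := normr_ge0 Mr.
  by have := normr_ge0 (dot (u t) (u t)); lra.
- apply: (@le_trans _ _ Mr); first by move: st; near: s.
  have := ler_norm Mr; have := normr_ge0 Ml.
  by have := normr_ge0 (dot (u t) (u t)); lra.
- by rewrite lerDl addr_ge0.
Unshelve. all: by end_near. Qed.

(** Each exceptional time in the interior splits the interval in two; without
    exceptional times this is the mean value theorem. *)
Lemma nonincreasing_off_finite (f : R -> R) (s : seq R) a b :
  a <= b -> {within `[a, b], continuous f} ->
  (forall t, t \in `]a, b[ -> t \notin s ->
     derivable f t 1 /\ f^`()%classic t <= 0) ->
  f b <= f a.
Proof.
elim: s a b => [|c s IH] a b ab cf df.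
  by apply: (@ler0_derive1_nincr _ f a b) => // t tab; have [] := df t tab.
have [cab|cab] := boolP (c \in `]a, b[).
- have [ac cb] : a < c /\ c < b by move: cab; rewrite in_itv => /andP[].
  apply: (@le_trans _ _ (f c)); apply: IH => //; try exact: ltW.
  + apply: continuous_subspaceW cf => t /=; rewrite !in_itv/=; lra.
  + move=> t tcb ts; apply: df; first by move: tcb; rewrite !in_itv/=; lra.
    rewrite inE negb_or ts andbT; move: tcb; rewrite in_itv/= => /andP[ct _].
    by rewrite gt_eqF.
  + apply: continuous_subspaceW cf => t /=; rewrite !in_itv/=; lra.
  + move=> t tcb ts; apply: df; first by move: tcb; rewrite !in_itv/=; lra.
    rewrite inE negb_or ts andbT; move: tcb; rewrite in_itv/= => /andP[_ ct].
    by rewrite lt_eqF.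
- apply: IH => // t tab ts; apply: df => //; rewrite inE negb_or ts andbT.
  by apply: contraNneq cab => <-.
Qed.

(** Where [h] is continuous, the fundamental theorem of calculus says that
    [g - H] has derivative [g' - h <= 0], with [H x] the integral of [h] from
    [a] to [x]. Being continuous across the finitely many other times as well,
    [g - H] does not increase from [a] to [b]. *)
Lemma le_Rintegral_off_finite (g h : R -> R) (S : set R) a b :
  a < b -> finite_set S -> {within `[a, b], continuous g} ->
  mu.-integrable `[a, b] (EFin \o h) ->
  (forall t, t \in `]a, b[ -> ~ S t -> [/\ {for t, continuous h},
     derivable g t 1 & g^`()%classic t <= h t]) ->
  g b - g a <= \int[mu]_(t in `[a, b]) h t.
Proof.
move=> ab /finite_seqP[s Ss] cg ih gh.
pose H x := parameterized_integral mu a x h.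
have Ha : H a = 0 by rewrite /H /parameterized_integral set_itv1 Rintegral_set1.
suff : (g - H) b <= (g - H) a.
  by rewrite !fctE Ha /H/parameterized_integral; lra.
apply: (@nonincreasing_off_finite _ s); first exact: ltW.
  have /subspace_continuousP cH := parameterized_integral_continuous (ltW ab) ih.
  move/subspace_continuousP : cg => cg; apply/subspace_continuousP => x xab.
  by apply: cvgB; [exact: cg|exact: cH].
move=> t tab ts; have [|ch dg gh'] := gh t tab.
  by rewrite Ss /=; exact/negP.
move: tab; rewrite in_itv/= => /andP[at_ tb].
have [dH H'] := @continuous_FTC1 R h (BLeft a) t b tb ih at_ ch.
split; first exact: derivableB.
rewrite derive1E deriveB // -!derive1E.
by rewrite [X in _ - X]H' subr_le0.
Qed.

Lemma finite_measurable (S : set (measurableTypeR R)) :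
  finite_set S -> measurable S.
Proof.
move=> fS; apply: countable_measurable; first exact: measurable_set1.
exact: finite_set_countable.
Qed.

(** Local boundedness on a compact interval is global boundedness, and
    changing the domain by finitely many points preserves measurability. *)
Lemma integrable_off_finite (h : R -> R) (S : set R) a b :
  a < b -> finite_set S ->
  (forall t, t \in `]a, b[ -> ~ S t -> {for t, continuous h}) ->
  (forall t, t \in `[a, b] ->
     exists M : R, \forall s \near t, s \in `[a, b] -> `|h s| <= M) ->
  mu.-integrable `[a, b] (EFin \o h).
Proof.
move=> ab fS ch bh.
apply: measurable_bounded_integrable => //.
- by rewrite /= lebesgue_measure_itv /= lte_fin ab -EFinB ltry.
- pose E := S `|` [set a; b].
  have fE : finite_set E.
    by rewrite finite_setU; split => [//|]; exact: finite_set2.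
  have oD : open (`]a, b[ `\` E).
    have T1 := hausdorff_accessible (@Rhausdorff R).
    rewrite setDE; apply: openI; first exact: interval_open.
    exact/closed_openC/(accessible_finite_set_closed.1 T1 E fE).
  have -> : [set` `[a, b]] = (`]a, b[ `\` E) `|` (`[a, b] `&` E).
    apply/seteqP; split => t /=; rewrite !in_itv/=.
      move=> tab; have [Et|nE] := pselect (E t); [by right|left; split => //].
      have : t != a /\ t != b.
        by split; apply/eqP => e; apply: nE; right; [left|right].
      by case=> ta tb; rewrite !lt_neqAle (eq_sym a) ta tb.
    by case=> [[]|[]] //; lra.
  have mD := measurable_realfun.open_measurable oD.
  apply/measurable_funU => //.
    by apply: finite_measurable; exact: finite_setIr.
  split.
    apply: measurable_realfun.open_continuous_measurable_fun => // t.
    by rewrite inE => -[tab nE]; apply: ch => // St; apply: nE; left.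
  move=> _ Y _; apply: finite_measurable; apply: finite_setIl.
  exact: finite_setIr.
- have /compact_near_coveringP/near_covering_withinP := @segment_compact R a b.
  move=> /(_ R (pinfty_nbhs R) (fun M t => `|h t| <= M)).
  have FF : Filter (pinfty_nbhs R) by exact: _.
  move=> /(_ FF)[].
    move=> t tab; have [M hM] := bh t tab.
    have nM : \forall M' \near +oo, M <= M' :> R.
      exact: nbhs_pinfty_ge (num_real M).
    exists ([set t' | t' \in `[a, b] -> `|h t'| <= M], [set M' | M <= M']).
      by split.
    by move=> [t' M'] /= [ht' MM'] /ht' /le_trans; apply.
  move=> M [_ hM]; exists M; split=> [|k Mk t tab]; first exact: num_real.
  exact: hM.
Qed.

End Regularity.

(** * Event instants *)

Section EventTriggering.
Context {R : realType} {m : nat}.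
Implicit Types (T : \bar R) (delta : R) (y yh : R -> 'cV[R]_m).
Implicit Types (tau : nat -> \bar R).

Lemma event_instantsS {T delta y tau} k :
  event_instants T delta y tau -> (tau k <= tau k.+1)%E.
Proof.
by case=> _ tauS _; rewrite tauS; apply/ereal_infP => _ [t [] /ltW ? _ _ <-].
Qed.

Lemma event_instants_ndecr {T delta y tau} :
  event_instants T delta y tau ->
  {homo tau : j k / (j <= k)%N >-> (j <= k)%E}.
Proof.
move=> ev; apply: homo_leq => //; first exact: le_trans.
by move=> k; exact: event_instantsS ev.
Qed.

Lemma event_instants_ge0 {T delta y tau} k :
  event_instants T delta y tau -> (0 <= tau k)%E.
Proof.
move=> ev; have [tau0 _ _] := ev.
by rewrite -tau0; exact: event_instants_ndecr ev _ _ (leq0n k).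
Qed.

(** A violation of the bound at [t] would put [t] in the set of which
    [tau k.+1] is the infimum, hence [tau k.+1 <= t]. *)
Lemma event_error_le {T delta y tau} k t :
  event_instants T delta y tau -> horizon T t ->
  (tau k < t%:E < tau k.+1)%E ->
  dot (y t - y (fine (tau k))) (y t - y (fine (tau k))) <=
  delta * dot (y t) (y t).
Proof.
move=> [_ tauS _] [_ tT] /andP[kt tk]; rewrite leNgt; apply/negP => lt_e.
move: tk; rewrite tauS ltNge => /negP; apply.
apply: ereal_inf_lbound; exists t => //; split=> //; exact: lt_e.
Qed.

(** Strictly between two events nothing is transmitted: this is what makes the
    input of a subsystem continuous wherever the external input is. *)
Lemma held_locally_constant {T delta y yh tau t} :
  event_instants T delta y tau -> sample_and_hold T tau y yh ->
  horizon T t -> inter_event tau t ->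
  0 < t /\ \forall s \near t, horizon T s /\ yh s = yh t.
Proof.
move=> ev sh [t0 tT] [k /andP[kt tk]].
have k0 := event_instants_ge0 k ev.
have {}t0 : 0 < t by rewrite -lte_fin (le_lt_trans k0).
split=> //; near=> s.
have hs : horizon T s.
  split; first by apply: ltW; near: s; exact: lt_nbhsr.
  by near: s; apply: open_nbhs_nbhs; split; [exact: open_ereal_lt|].
split=> //; rewrite (sh k s) // ?(sh k t) //.
- by split; [exact: ltW|].
- by rewrite (ltW kt) tk.
apply/andP; split; last first.
  by near: s; apply: open_nbhs_nbhs; split; [exact: open_ereal_lt|].
by apply/ltW; near: s; apply: open_nbhs_nbhs; split; [exact: open_ereal_gt|].
Unshelve. all: by end_near. Qed.

(** If [t1] lies in [[tau K, tau K.+1[], only the events [tau 0, ..., tau K]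
    can occur up to [t1]. *)
Lemma finitely_many_events {T delta y tau t1} :
  event_instants T delta y tau -> horizon T t1 ->
  finite_set [set t | 0 <= t <= t1 /\ ~ inter_event tau t].
Proof.
move=> ev ht1; have [_ _ cover] := ev.
have [K /andP[_ t1K]] := cover _ ht1.
apply: (@sub_finite_set _ _ ((fun k => fine (tau k)) @` `I_K.+1)); last first.
  exact/finite_image/finite_II.
move=> t [/andP[t0 tt1] nt].
have [k /andP[kt tk]] : exists k, (tau k <= t%:E < tau k.+1)%E.
  apply: cover; split=> //; case: ht1 => _; apply: le_lt_trans.
  by rewrite lee_fin.
exists k => /=; last first.
  move: kt; rewrite le_eqVlt => /orP[/eqP -> //|kt].
  by exfalso; apply: nt; exists k; rewrite kt tk.
rewrite ltnS leqNgt; apply/negP => Kk.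
have := le_trans (event_instants_ndecr ev _ _ Kk) kt.
by rewrite leNgt (le_lt_trans _ t1K) // lee_fin.
Qed.

End EventTriggering.

(** * Dissipativity of the loop *)

Section Loop.
Context {R : realType} {np nc m : nat}.
Context {Gp : system R np m} {Gc : system R nc m} {delta_p delta_c : R}.
Let NCS := event_triggered_loop Gp Gc delta_p delta_c.
Let X := states Gp `*` states Gc.

(** The times at which the loop has to satisfy its dissipation inequality are
    times at which both subsystems satisfy theirs, with the inputs expressed by
    sampling errors that obey the triggering bounds. *)
Lemma loop_subsystems {T w x y J t} : NCS T w x y J -> J t ->
  exists up uc Jp Jc ep ec,
  [/\ solution Gp T up (fun t => (x t).1) (usubmx \o y) Jp /\ Jp t,
      solution Gc T uc (fun t => (x t).2) (dsubmx \o y) Jc /\ Jc t,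
      up t = usubmx (w t) - (dsubmx (y t) - ec) /\
        uc t = dsubmx (w t) + (usubmx (y t) - ep),
      dot ep ep <= delta_p * dot (usubmx (y t)) (usubmx (y t)) &
      dot ec ec <= delta_c * dot (dsubmx (y t)) (dsubmx (y t))].
Proof.
move=> [pcw [up [uc [yph [ych [tp [tc [Jp [Jc]]]]]]]]].
move=> [[solp solc] [evp evc] [shp shc] feedback ->] [ht itp itc cw].
have [t0 nearp] := held_locally_constant evp shp ht itp.
have [_ nearc] := held_locally_constant evc shc ht itc.
have [ucE upE] := feedback t ht.
exists up, uc, Jp, Jc, (usubmx (y t) - yph t), (dsubmx (y t) - ych t).
have cup : {for t, continuous up}.
  have cw1 : {for t, continuous (fun s => usubmx (w s) - ych t)}.
    apply: continuousB; last exact: cst_continuous.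
    by apply: (continuous_comp cw); exact: usubmx_continuous.
  rewrite /prop_for /continuous_at upE.
  apply: cvg_trans cw1; apply: near_eq_cvg.
  by apply: filterS nearc => s [hs <-]; have [_ ->] := feedback s hs.
have cuc : {for t, continuous uc}.
  have cw2 : {for t, continuous (fun s => dsubmx (w s) + yph t)}.
    apply: continuousD; last exact: cst_continuous.
    by apply: (continuous_comp cw); exact: dsubmx_continuous.
  rewrite /prop_for /continuous_at ucE.
  apply: cvg_trans cw2; apply: near_eq_cvg.
  by apply: filterS nearp => s [hs <-]; have [-> _] := feedback s hs.
split.
- by split=> //; case: solp => _ _ _ -> _; split.
- by split=> //; case: solc => _ _ _ -> _; split.
- by rewrite ucE upE !subKr.
- move: itp => [k kt]; rewrite (shp k t) //; last first.
    by case/andP: kt => /ltW -> ->.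
  exact: event_error_le evp ht kt.
- move: itc => [k kt]; rewrite (shc k t) //; last first.
    by case/andP: kt => /ltW -> ->.
  exact: event_error_le evc ht kt.
Qed.

Lemma storage_derivable {n} {G : system R n m} {T u x y J t V} :
  solution G T u x y J -> J t -> storage_function (states G) V ->
  derivable (V \o x) t 1.
Proof.
move=> [_ [_ stx] _ JE sol] Jt [_ dV].
have dx : derivable x t 1 by have [] := sol t Jt.
apply/derivable1_diffP/differentiable_comp; first exact/derivable1_diffP.
by apply/dV/stx; move: Jt; rewrite JE => -[].
Qed.

Lemma loop_states {T w x y J t} : NCS T w x y J -> horizon T t -> X (x t).
Proof.
move=> [_ [up [uc [yph [ych [tp [tc [Jp [Jc]]]]]]]]].
move=> [[[_ [_ stp] _ _ _] [_ [_ stc] _ _ _]] _ _ _ _] ht.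
by split; [exact: stp|exact: stc].
Qed.

Lemma loop_storage_derivable {T w x y J t V} :
  NCS T w x y J -> J t -> storage_function X V -> derivable (V \o x) t 1.
Proof.
move=> loop Jt [_ dV].
have [up [uc [Jp [Jc [ep [ec]]]]]] := loop_subsystems loop Jt.
move=> [[[_ _ _ JpE solp] Jpt] [[_ _ _ _ solc] Jct] _ _ _].
have dxp : derivable (fun t => (x t).1) t 1 by have [] := solp t Jpt.
have dxc : derivable (fun t => (x t).2) t 1 by have [] := solc t Jct.
apply/derivable1_diffP/differentiable_comp; last first.
  by apply/dV/(loop_states loop); move: Jpt; rewrite JpE => -[].
rewrite (_ : x = fun t => ((x t).1, (x t).2)); last first.
  by apply/funext => s; case: (x s).
by apply: differentiable_pair; exact/derivable1_diffP.
Qed.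

Definition sum_storage (Vp : 'cV[R]_np -> R) (Vc : 'cV[R]_nc -> R)
  (z : 'cV[R]_np * 'cV[R]_nc) : R := Vp z.1 + Vc z.2.

Lemma sum_storage_function Vp Vc :
  storage_function (states Gp) Vp -> storage_function (states Gc) Vc ->
  storage_function X (sum_storage Vp Vc).
Proof.
move=> [Vp0 dVp] [Vc0 dVc]; split=> [z [zp zc]|z [zp zc]].
  by rewrite addr_ge0 ?Vp0 ?Vc0.
apply: differentiableD.
  apply: (differentiable_comp (f := fst)); last exact: dVp.
  by apply: linear_differentiable => ?; exact: cvg_fst.
apply: (differentiable_comp (f := snd)); last exact: dVc.
by apply: linear_differentiable => ?; exact: cvg_snd.
Qed.

(** The storage functions add up, and so do the two supply rates. *)
Lemma loop_dissipation (nu_p rho_p nu_c rho_c : R) Vp Vc :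
  0 < delta_p -> 0 < delta_c ->
  storage_function (states Gp) Vp -> storage_function (states Gc) Vc ->
  dissipation_inequality (solution Gp) Vp
    (fun u y => dot u y - rho_p * dot y y - nu_p * dot u u) ->
  dissipation_inequality (solution Gc) Vc
    (fun u y => dot u y - rho_c * dot y y - nu_c * dot u u) ->
  dissipation_inequality NCS (sum_storage Vp Vc) (fun w y =>
    let w1 := usubmx w in let w2 := dsubmx w in
    let yp := usubmx y in let yc := dsubmx y in
    - (nu_p - `|nu_p|) * dot w1 w1 - (nu_c - `|nu_c|) * dot w2 w2
    + 2 * (2^-1 * dot w1 yp + nu_p * dot w1 yc
           - nu_c * dot w2 yp + 2^-1 * dot w2 yc)
    - (beta rho_p delta_p nu_c - 4^-1) * dot yp yp
    - (beta rho_c delta_c nu_p - 4^-1) * dot yc yc).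
Proof.
move=> dp0 dc0 sVp sVc hp hc T w x y J loop t Jt.
have [up [uc [Jp [Jc [ep [ec]]]]]] := loop_subsystems loop Jt.
move=> [[solp Jpt] [solc Jct] [upE ucE] hep hec].
apply: le_trans (loop_supply_le _ _ nu_p rho_p nu_c rho_c _ _ _ _ _ _ _ _
  dp0 dc0 hep hec upE ucE).
have dVp := storage_derivable solp Jpt sVp.
have dVc := storage_derivable solc Jct sVc.
rewrite (_ : _ \o x = (Vp \o (fun t => (x t).1)) + (Vc \o (fun t => (x t).2)));
  last by apply/funext.
rewrite derive1E deriveD // -!derive1E lerD //; [exact: hp solp _ Jpt|].
exact: hc solc _ Jct.
Qed.

End Loop.

(** * Finite gain of the loop *)

Section FiniteGain.
Context {R : realType} {np nc m : nat}.
Context {Gp : system R np m} {Gc : system R nc m} {delta_p delta_c : R}.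
Let NCS := event_triggered_loop Gp Gc delta_p delta_c.
Let X := states Gp `*` states Gc.

Lemma loop_storage_continuous {T w x y J t1 V} :
  NCS T w x y J -> horizon T t1 -> storage_function X V ->
  {within `[0, t1], continuous (V \o x)}.
Proof.
move=> loop ht1 [_ dV]; apply/subspace_continuousP => t tI.
have sub : `[0, t1] `<=` horizon T.
  move=> s /=; rewrite in_itv/= => /andP[s0 st1]; split=> //.
  by case: ht1 => _; apply: le_lt_trans; rewrite lee_fin.
have Xt := loop_states loop (sub t tI).
move: loop => [_ [up [uc [yph [ych [tp [tc [Jp [Jc]]]]]]]]].
move=> [[[_ [xp _] _ _ _] [_ [xc _] _ _ _]] _ _ _ _].
move: xp => /(continuous_subspaceW sub)/subspace_continuousP/(_ t tI) xp.
move: xc => /(continuous_subspaceW sub)/subspace_continuousP/(_ t tI) xc.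
have xt : x @ within `[0, t1] (nbhs t) --> x t.
  rewrite (_ : x = fun t => ((x t).1, (x t).2)); last first.
    by apply/funext => s; case: (x s).
  exact: cvg_pair xp xc.
exact: (cvg_comp x V xt (differentiable_continuous (dV _ Xt))).
Qed.

(** Integration of the dissipation inequality. The derivative of [V \o x] is
    controlled only off the events and the discontinuities of the signals; up
    to any given time these are finitely many, and [V \o x] is continuous
    across them. *)
Lemma loop_finite_gain V (gamma : R) : 0 < gamma -> storage_function X V ->
  dissipation_inequality NCS V
    (fun w y => gamma ^+ 2 * dot w w - dot y y) ->
  finite_gain_L2_stable X NCS.
Proof.
move=> g0 sV dissV; exists V, gamma; split=> //; first by case: sV.
move=> T w x y J loop t1 t10 t1T.
have ht1 : horizon T t1 by split=> //; exact: ltW.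
have htI t : t \in `[0, t1] -> horizon T t.
  rewrite in_itv/= => /andP[t0 tt1]; split=> //.
  by apply: le_lt_trans t1T; rewrite lee_fin.
have [pw [up [uc [yph [ych [tp [tc [Jp [Jc]]]]]]]]] := loop.
move=> [[[[_ py1] _ _ _ _] [[_ py2] _ _ _ _]] [evp evc] _ _ JE].
pose disc p (u : R -> 'cV[R]_p) :=
  [set t | 0 < t <= t1 /\ ~ {for t, continuous u}].
(* The discontinuities of the outputs are removed too, because the fundamental
   theorem of calculus is applied at continuity points of the supply rate. *)
pose S := (disc _ w `|` (disc _ (usubmx \o y) `|` disc _ (dsubmx \o y))) `|`
  ([set t | 0 <= t <= t1 /\ ~ inter_event tp t] `|`
   [set t | 0 <= t <= t1 /\ ~ inter_event tc t]).
have fS : finite_set S.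
  rewrite !finite_setU; split; [split; [|split]|split].
  - by case: pw => _ _ /(_ t1 ht1).
  - by case: py1 => _ _ /(_ t1 ht1).
  - by case: py2 => _ _ /(_ t1 ht1).
  - exact: finitely_many_events evp ht1.
  - exact: finitely_many_events evc ht1.
pose h t := gamma ^+ 2 * dot (w t) (w t) - dot (y t) (y t).
have hE : h = fun t => gamma ^+ 2 * dot (w t) (w t) -
    (dot (usubmx (y t)) (usubmx (y t)) + dot (dsubmx (y t)) (dsubmx (y t))).
  by apply/funext => t; rewrite /h (dot_vsub (y t)).
have regular t : t \in `]0, t1[ -> ~ S t -> {for t, continuous h} /\ J t.
  move=> tI nS; have := tI; rewrite in_itv/= => /andP[t0 tt1].
  have tt1' := ltW tt1.
  have cont p (u : R -> 'cV[R]_p) : ~ disc p u t ->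
      {for t, continuous (fun s => dot (u s) (u s))}.
    move=> nd; have cu : {for t, continuous u}.
      by apply: contrapT => ncu; apply: nd; split; rewrite ?t0.
    exact: (cvg_comp u (fun x => dot x x) cu (dot_sqr_continuous (u t))).
  split.
    rewrite hE; apply: continuousB; first apply: continuousM.
    - exact: cst_continuous.
    - by apply: cont => d; apply: nS; left; left.
    apply: continuousD.
    - by apply: (cont _ (usubmx \o y)) => d; apply: nS; left; right; left.
    - by apply: (cont _ (dsubmx \o y)) => d; apply: nS; left; right; right.
  rewrite JE; split.
  - by apply: htI; rewrite in_itv/= (ltW t0).
  - apply: contrapT => n; apply: nS; right; left.
    by split; rewrite ?(ltW t0).
  - apply: contrapT => n; apply: nS; right; right.
    by split; rewrite ?(ltW t0).
  - apply: contrapT => n; apply: nS; left; left.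
    by split; rewrite ?t0.
apply: (@le_Rintegral_off_finite _ (V \o x) h S) => //.
- exact: loop_storage_continuous loop ht1 sV.
- apply: (integrable_off_finite _ _ _ _ t10 fS) => [t tI nS|t tI].
    by have [] := regular t tI nS.
  have ht := htI t tI.
  have [Mw hw] := sqr_locally_bounded pw ht.
  have [M1 h1] := sqr_locally_bounded py1 ht.
  have [M2 h2] := sqr_locally_bounded py2 ht.
  exists (gamma ^+ 2 * Mw + (M1 + M2)); near=> s => sI.
  have s0 : 0 <= s by move: sI; rewrite in_itv/= => /andP[].
  rewrite hE; apply: le_trans (ler_normB _ _) _; apply: lerD.
    rewrite normrM ger0_norm ?sqr_ge0 // ler_wpM2l ?sqr_ge0 //.
    exact: (near hw s).
  apply: le_trans (ler_normD _ _) _; apply: lerD.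
    exact: (near h1 s).
  exact: (near h2 s).
- move=> t tI nS; have [ch Jt] := regular t tI nS.
  split=> //; first exact: loop_storage_derivable loop Jt sV.
  exact: dissV loop t Jt.
Unshelve. all: by end_near. Qed.

End FiniteGain.

Theorem theorem10 (R : realType) (np nc m : nat) (hm : (0 < m)%N)
    (Gp : system R np m) (Gc : system R nc m)
    (nu_p rho_p nu_c rho_c delta_p delta_c : R)
    (hGp : IF_OFP Gp nu_p rho_p) (hGc : IF_OFP Gc nu_c rho_c)
    (hdp : 0 < delta_p <= 1) (hdc : 0 < delta_c <= 1) :
  let X := states Gp `*` states Gc in
  let NCS := event_triggered_loop Gp Gc delta_p delta_c in
  let beta_p := beta rho_c delta_c nu_p in
  let beta_c := beta rho_p delta_p nu_c in
  let Sm : 'M[R]_(m + m) :=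
    block_mx (2^-1)%:M nu_p%:M (- nu_c)%:M (2^-1)%:M in
  let Rm : 'M[R]_(m + m) :=
    block_mx (- (nu_p - `|nu_p|))%:M 0 0 (- (nu_c - `|nu_c|))%:M in
  let Qm : 'M[R]_(m + m) :=
    block_mx (- (beta_c - 4^-1))%:M 0 0 (- (beta_p - 4^-1))%:M in
  [/\ QSR_dissipative X NCS Qm Sm^T Rm,
      exists V, storage_function X V /\
        dissipation_inequality NCS V
          (fun w y => bform w Rm w + 2 * bform w Sm y + bform y Qm y),
      negative_definite Qm <-> 4^-1 < beta_c /\ 4^-1 < beta_p &
      negative_definite Qm -> finite_gain_L2_stable X NCS].
Proof.
move=> X NCS beta_p beta_c Sm Rm Qm.
move: hdp hdc => /andP[dp0 _] /andP[dc0 _].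
have [Vp [sVp dissp]] := hGp; have [Vc [sVc dissc]] := hGc.
pose V := sum_storage Vp Vc.
have sV : storage_function X V by exact: sum_storage_function.
have dissV : dissipation_inequality NCS V
    (fun w y => bform w Rm w + 2 * bform w Sm y + bform y Qm y).
  move=> T w x y J loop t Jt.
  apply: le_trans (loop_dissipation _ _ _ _ _ _ dp0 dc0 sVp sVc dissp dissc
    _ _ _ _ _ loop _ Jt) _.
  rewrite !bform_diag_block bform_scalar_block /beta_p /beta_c /=.
  by lra.
have Qm_nd := negative_definite_diag_block (beta_c - 4^-1) (beta_p - 4^-1) hm.
split.
- split; [by rewrite tr_block_mx !tr_scalar_mx !trmx0..|].
  exists V; split=> // T w x y J loop t Jt.
  apply: le_trans (dissV _ _ _ _ _ loop _ Jt) _.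
  by rewrite bform_tr addrAC addrC addrA (addrC (bform (y t) _ _)) addrAC.
- by exists V.
- by rewrite Qm_nd !subr_gt0.
- move=> /Qm_nd[qc0 qp0].
  pose eps := Num.min (beta_c - 4^-1) (beta_p - 4^-1).
  have eps0 : 0 < eps by rewrite lt_min qc0.
  have Qeps y : bform y Qm y <= - eps * dot y y.
    have ec : eps <= beta_c - 4^-1 by rewrite ge_min lexx.
    have ep : eps <= beta_p - 4^-1 by rewrite ge_min lexx orbT.
    by rewrite bform_diag_block dot_vsub mulrDr lerD // ler_wpM2r ?dot_ge0
      ?lerN2.
  have [k [gamma [k0 g0 gain]]] := quadratic_supply_gain Qm Sm Rm eps eps0 Qeps.
  apply: (loop_finite_gain (fun z => k * V z) gamma) => //.
    split=> [z Xz|z Xz]; first by rewrite mulr_ge0 ?(ltW k0) //; apply: sV.1.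
    by apply: differentiableM; [exact: differentiable_cst|exact: sV.2].
  move=> T w x y J loop t Jt; apply: le_trans (gain _ _).
  rewrite [leLHS](_ : _ = k * derive1 (V \o x) t).
    by rewrite ler_wpM2l ?(ltW k0) //; exact: dissV loop _ Jt.
  rewrite -derive1Ml //; exact: loop_storage_derivable loop Jt sV.
Qed.
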